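(* Let $x_1,\dots,x_N$ be points of a normed space, $\mathcal{D}=\{x_i\}_{i=1}^N$, let $1\le B\le N$, and let $\mathcal{P}=\{\pi\in\{0,1\}^N : \pi^\top\mathbf{1}=B\}$. Let $\Lambda^0=\emptyset$ and let $\hat\pi^0\in\mathcal{P}$ be arbitrary. Suppose that in each iteration $t\in\{0,1,2,\dots\}$ one computes $W(\mathcal{C}(\hat\pi^t),\mathcal{D})$ to obtain an optimal dual variable $\hat\lambda^t\in\mathbb{R}^N$ (a maximizer in the Lagrangian $L(\hat\pi^t)$ defined in the context), sets $\Lambda^{t+1}=\Lambda^t\cup\{\hat\lambda^t\}$, and solves the relaxed master problem W-RMP$(\Lambda^{t+1})$ (defined in the context) to obtain an optimal solution $(\hat\eta^{t+1},\hat\pi^{t+1})$. Then for any $\varepsilon>0$ there exists a finite $t^*$ for which $$W(\mathcal{C}(\hat\pi^{t^*}),\mathcal{D})-\hat\eta^{t^*}<\varepsilon .$$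
   Context: Let $D_x=[\|x_i-x_{i'}\|]_{i,i'=1}^{N}$, let $\langle A,A'\rangle=\mathrm{Trace}(A^\top A')$, and let $\mathbf{1}\in\mathbb{R}^N$ be the all-ones vector. For $\pi\in\mathcal{P}$, $\mathcal{C}(\pi)$ is the set of points $x_i$ with $\pi_i=1$, and $$W(\mathcal{C}(\pi),\mathcal{D})=\min_{\Gamma\ge 0}\left\{\langle D_x,\Gamma\rangle : \Gamma\mathbf{1}=\tfrac1N\mathbf{1},\ \Gamma^\top\mathbf{1}=\tfrac1B\pi\right\}$$ is the discrete Wasserstein distance ($\Gamma\in\mathbb{R}^{N\times N}$, inequality entrywise). Let $\mathcal{G}=\{\Gamma\in\mathbb{R}^{N\times N}:\Gamma\ge0,\ \Gamma\mathbf{1}=\mathbf{1}/N\}$. The Lagrangian is $$L(\pi)=\sup_{\lambda\in\mathbb{R}^N}\ \inf_{\Gamma\in\mathcal{G}}\left\{\langle D_x,\Gamma\rangle+\lambda^\top\left(\tfrac1B\pi-\Gamma^\top\mathbf{1}\right)\right\},$$ which equals $W(\mathcal{C}(\pi),\mathcal{D})$; the dual variable obtained when computing $W(\mathcal{C}(\pi),\mathcal{D})$ is a $\lambda$ attaining this supremum. For a finite set $\Lambda\subset\mathbb{R}^N$, the relaxed master problem W-RMP$(\Lambda)$ is $$\min_{\eta\in\mathbb{R},\ \pi\in\mathcal{P}}\ \eta\quad\text{subject to}\quad \eta\ge\inf_{\Gamma\in\mathcal{G}}\left\{\langle D_x,\Gamma\rangle+\hat\lambda^\top\left(\tfrac1B\pi-\Gamma^\top\mathbf{1}\right)\right\}\quad\text{for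 all }\hat\lambda\in\Lambda .$$ The values $\hat\eta^t$ are defined for $t\ge1$, so $t^*\ge 1$. *)

(* Defs.v *)
From HB Require Import structures.
From mathcomp Require Import all_boot all_order all_algebra.
From mathcomp Require Import all_classical all_reals all_analysis.

Set Implicit Arguments.
Unset Strict Implicit.
Unset Printing Implicit Defensive.

Import Order.TTheory GRing.Theory Num.Theory.
Import numFieldNormedType.Exports.

Local Open Scope classical_set_scope.
Local Open Scope ring_scope.

Definition ones (R : realType) (N : nat) : 'cV[R]_N := const_mx 1.

Definition dist_mx (R : realType) (V : normedModType R) (N : nat)
    (x : 'I_N -> V) : 'M[R]_N :=
  \matrix_(i, i') `|x i - x i'|.

Definition frob (R : realType) (N : nat) (A A' : 'M[R]_N) : R :=
  \tr (A^T *m A').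

Definition selections (R : realType) (N B : nat) : set 'cV[R]_N :=
  [set p : 'cV[R]_N | (forall i, p i 0 = 0 \/ p i 0 = 1) /\
           (p^T *m ones R N) 0 0 = B%:R].

Definition transport_plans (R : realType) (N : nat) : set 'M[R]_N :=
  [set G : 'M[R]_N | (forall i j, 0 <= G i j) /\
           G *m ones R N = N%:R^-1 *: ones R N].

(* The infima and supremum below are taken in [\bar R], so that no default
   value is attached to an empty or unbounded set. *)

(* W(C(p), D): the distance between the uniform distribution on the selected
   points (those x i with p i = 1) and the uniform distribution on all the
   points.  For p in [selections] the infimum is finite and is attained, the
   feasible set being nonempty and compact. *)
Definition wasserstein (R : realType) (V : normedModType R) (N : nat)
    (x : 'I_N -> V) (B : nat) (p : 'cV[R]_N) : \bar R :=
  ereal_inf [set (frob (dist_mx x) G)%:E | G in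
    [set G : 'M[R]_N | [/\ forall i j, 0 <= G i j,
                           G *m ones R N = N%:R^-1 *: ones R N &
                           G^T *m ones R N = B%:R^-1 *: p]]].

Definition dual_value (R : realType) (V : normedModType R) (N : nat)
    (x : 'I_N -> V) (B : nat) (lam p : 'cV[R]_N) : \bar R :=
  ereal_inf [set (frob (dist_mx x) G +
      (lam^T *m (B%:R^-1 *: p - G^T *m ones R N)) 0 0)%:E
    | G in @transport_plans R N].

Definition lagrangian (R : realType) (V : normedModType R) (N : nat)
    (x : 'I_N -> V) (B : nat) (p : 'cV[R]_N) : \bar R :=
  ereal_sup [set dual_value x B lam p | lam in [set: 'cV[R]_N]].

Definition optimal_dual (R : realType) (V : normedModType R) (N : nat)
    (x : 'I_N -> V) (B : nat) (p lam : 'cV[R]_N) : Prop :=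
  dual_value x B lam p = lagrangian x B p.

Definition rmp_feasible (R : realType) (V : normedModType R) (N : nat)
    (x : 'I_N -> V) (B : nat) (Lam : set 'cV[R]_N)
    (eta : R) (p : 'cV[R]_N) : Prop :=
  selections B p /\
  (forall lam, Lam lam -> (dual_value x B lam p <= eta%:E)%E).

Definition rmp_optimal (R : realType) (V : normedModType R) (N : nat)
    (x : 'I_N -> V) (B : nat) (Lam : set 'cV[R]_N)
    (eta : R) (p : 'cV[R]_N) : Prop :=
  rmp_feasible x B Lam eta p /\
  (forall eta' p', rmp_feasible x B Lam eta' p' -> eta <= eta').

(* Main.v *)
(* Once a selection repeats, say p s = p t with s < t, the multiplier lam s
   computed at p s is a cut of the master problem solved by p t, so eta t is at
   least the Lagrangian at p s = p t, i.e. the Wasserstein distance; a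
   repetition occurs because there are finitely many selections.  Strong
   duality is obtained without Farkas' lemma: for w below the optimal value, a
   quadratic penalty k |q - g u|^2 with k large lifts the objective above w on
   the compact set of plans, and at a minimizer u of the penalized objective
   the first-order condition says that lam = 2 k (q - g u) has dual value at
   least w. *)
Require Import Defs.
From mathcomp Require Import all_boot all_order all_algebra.
From mathcomp Require Import all_classical all_reals all_analysis.
From mathcomp Require Import ring lra.
Import Order.TTheory GRing.Theory Num.Theory.
Import numFieldNormedType.Exports.
Local Open Scope classical_set_scope.
Local Open Scope ring_scope.

Lemma continuous_sum (T : topologicalType) (R : realType) (I : Type)
    (r : seq I) (P : pred I) (F : I -> T -> R) :
  (forall i, continuous (F i)) ->
  continuous (fun u => \sum_(i <- r | P i) F i u).
Proof.
move=> cF; apply: continuous_big => //.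
exact: add_continuous.
Qed.

(** [a] is the one-sided derivative at 0 of a quadratic in [s]; if it were negative, the linear term
    would beat [s ^+ 2 * b] for small [s]. *)
Lemma slope_ge0 (R : realType) (a b : R) :
  (forall s, 0 < s -> s <= 1 -> 0 <= s * a + s ^+ 2 * b) -> 0 <= a.
Proof.
move=> h; rewrite leNgt; apply/negP => a0.
have [b0|b0] := leP b 0; first by have := h 1 ltr01 (lexx _); lra.
(* For this [s], [s * b <= - a / 2], hence [a + s * b <= a / 2 < 0]. *)
have s0 : 0 < Num.min 1 (- a / (2 * b)).
  by rewrite lt_min ltr01 divr_gt0 ?oppr_gt0// mulr_gt0.
have s1 : Num.min 1 (- a / (2 * b)) <= 1 by rewrite ge_min lexx.
have : Num.min 1 (- a / (2 * b)) <= - a / (2 * b) by rewrite ge_min lexx orbT.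
rewrite ler_pdivlMr ?mulr_gt0// => sb.
have := h _ s0 s1; set s := Num.min _ _ in s0 s1 sb *.
rewrite expr2 -mulrA -mulrDr pmulr_rge0//; lra.
Qed.

(** A level [w] strictly below the constrained values of [f] stands in for the optimal value, so no
    dual optimum has to be attained. When no point of [K] satisfies [g u = q], every [w]
    qualifies. *)
Lemma lagrange_multiplier (R : realType) (U : normedModType R) (n : nat)
    (K : set U) (f : {linear U -> R^o}) (g : {linear U -> 'cV[R]_n})
    (q : 'cV[R]_n) (w : R) :
  compact K ->
  (forall u v s, K u -> K v -> 0 <= s -> s <= 1 -> K (u + s *: (v - u))) ->
  continuous f -> (forall i, continuous (fun u => g u i 0)) ->
  (forall u, K u -> g u = q -> w < f u) ->
  exists lam : 'cV[R]_n,
    forall u, K u -> w <= f u + (lam^T *m (q - g u)) 0 0.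
Proof.
move=> cK convK cf cg hw.
have [K0|/set0P K0] := eqVneq K set0; first by exists 0 => u; rewrite K0.
pose sq (u : U) : R := \sum_i (q i 0 - g u i 0) ^+ 2.
have sq_ge0 u : 0 <= sq u by apply: sumr_ge0 => i _; exact: sqr_ge0.
have csq : continuous sq.
  apply: continuous_sum => i u.
  have cqg : (fun u => q i 0 - g u i 0) @ u --> q i 0 - g u i 0.
    by apply: cvgB; [exact: cvg_cst|exact: cg].
  exact: cvgM.
have [k k0 hk] : exists2 k : R, 0 <= k & forall u, K u -> w <= f u + k * sq u.
  pose S := K `&` f @^-1` [set y | y <= w].
  have cS : compact S.
    apply: (subclosed_compact _ cK) => //; last exact: subIsetl.
    apply: closedI; first exact: compact_closed.
    by apply: preimage_closed => //; exact: closed_le.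
  (* On S the constraint violation sq is bounded away from 0, and f is bounded
     below on K, so k = (w - min f) / min_S sq works. *)
  have [S0|/set0P S0] := eqVneq S set0.
    exists 0 => // u Ku; rewrite mul0r addr0 leNgt; apply/negP => fu.
    by have : S u; [split => //; exact: ltW|rewrite S0].
  have [u0 Su0 m0] := compact_EVT_min S0 cS (continuous_subspaceT csq).
  have [u1 Ku1 m1] := compact_EVT_min K0 cK (continuous_subspaceT cf).
  move: Su0; rewrite inE => -[Ku0 fu0].
  have sq0 : 0 < sq u0.
    rewrite lt_neqAle sq_ge0 andbT eq_sym; apply/eqP => /eqP.
    rewrite psumr_eq0; last by move=> i _; exact: sqr_ge0.
    move=> /allP e; have /(hw _ Ku0) : g u0 = q.
      apply/matrixP => i j; rewrite ord1.
      have := e i (mem_index_enum i).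
      by rewrite sqrf_eq0 subr_eq0 => /eqP.
    by rewrite ltNge fu0.
  have fu10 : f u1 <= w by apply: le_trans fu0; apply: m1; rewrite inE.
  exists ((w - f u1) / sq u0); first by rewrite divr_ge0 ?subr_ge0.
  move=> u Ku; have [fu|fu] := leP w (f u).
    by rewrite (le_trans fu)// lerDl mulr_ge0// divr_ge0 ?subr_ge0.
  have Su : u \in S by rewrite inE; split => //; exact: ltW.
  have h1 : f u1 <= f u by apply: m1; rewrite inE.
  have h2 : w - f u1 <= (w - f u1) / sq u0 * sq u.
    rewrite -mulrA ler_peMr ?subr_ge0// mulrC ler_pdivlMr// mul1r.
    exact: m0.
  by move: h1 h2; lra.
have cF : continuous (fun u => (f u : R) + k * sq u).
  by move=> u; apply: cvgD; [exact: cf|apply: cvgMl_tmp; exact: csq].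
have [u Ku mu] := compact_EVT_min K0 cK (continuous_subspaceT cF).
rewrite inE in Ku.
exists ((2 * k) *: (q - g u)) => v Kv.
apply: (le_trans (hk u Ku)).
pose D : R := \sum_i (g v i 0 - g u i 0) ^+ 2.
pose X : R := \sum_i (q i 0 - g u i 0) * (g v i 0 - g u i 0).
have -> : (((2 * k) *: (q - g u))^T *m (q - g v)) 0 0 =
    2 * k * sq u - 2 * k * X.
  rewrite mxE /sq /X !mulr_sumr -sumrB; apply: eq_bigr => i _.
  by rewrite !mxE; ring.
(* This is the derivative at [s = 0] of the penalized objective along the segment from its minimizer
   [u] to [v]; [k * D] is the coefficient of [s ^+ 2]. *)
have : 0 <= (f v - f u) - 2 * k * X.
  apply: (@slope_ge0 _ _ (k * D)) => s s0 s1.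
  have /mu : u + s *: (v - u) \in K.
    by rewrite inE; apply: convK => //; exact: ltW.
  have -> : sq (u + s *: (v - u)) = sq u - 2 * s * X + s ^+ 2 * D.
    rewrite /sq /X /D !mulr_sumr -sumrB -big_split/=; apply: eq_bigr => i _.
    have -> : g (u + s *: (v - u)) i 0 = g u i 0 + s * (g v i 0 - g u i 0).
      by rewrite linearD linearZ linearB !mxE.
    by ring.
  rewrite linearD linearZ linearB/= /GRing.scale/=; lra.
(* The goal is the sum of the slope inequality and [0 <= k * sq u]. *)
by have := mulr_ge0 k0 (sq_ge0 u); lra.
Qed.

(** Balls are defined entrywise and [vec_mx] only reindexes entries, so the same radius works on
    both sides. *)
Lemma vec_mx_continuous (R : realType) (m n : nat) :
  continuous (@vec_mx R m n).
Proof.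
move=> v A /= /nbhs_ballP[e e0 eA]; apply/nbhs_ballP; exists e => //= w [_ vw].
by apply: eA; split => // i j; rewrite !mxE.
Qed.

Lemma mx_segment_compact (R : realType) (m n : nat) (a b : R) :
  compact [set M : 'M[R]_(m, n) | forall i j, a <= M i j <= b].
Proof.
have cK : compact
    [set v : 'rV[R]_(m * n) | forall i, `[a, b]%classic (v ord0 i)].
  apply: (@rV_compact _ _ (fun=> `[a, b]%classic)) => _.
  exact: segment_compact.
have -> : [set M : 'M[R]_(m, n) | forall i j, a <= M i j <= b] =
    vec_mx @` [set v : 'rV[R]_(m * n) | forall i, `[a, b]%classic (v ord0 i)].
  apply/seteqP; split => [M hM|_ [v hv <-] i j]/=.
    exists (mxvec M); last by rewrite mxvecK.
    move=> k; case/mxvec_indexP: k => i j.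
    by rewrite mxvecE /= in_itv/=; exact: hM.
  by rewrite mxE; have := hv (mxvec_index i j); rewrite /= in_itv.
apply: continuous_compact => //; apply: continuous_subspaceT.
exact: vec_mx_continuous.
Qed.

Lemma transport_plansP (R : realType) (N : nat) (G : 'M[R]_N) :
  transport_plans G <->
  (forall i j, 0 <= G i j) /\ (forall i, \sum_j G i j = N%:R^-1).
Proof.
split=> -[G0 hG]; split => //.
  move=> i; move/matrixP : hG => /(_ i 0); rewrite !mxE mulr1 => <-.
  by apply: eq_bigr => j _; rewrite mxE mulr1.
apply/matrixP => i j; rewrite !mxE mulr1 -(hG i).
by apply: eq_bigr => k _; rewrite mxE mulr1.
Qed.

(** Nonnegative entries with row sums [N%:R^-1] are at most [N%:R^-1], so the plans form a closed
    subset of a compact cube. *)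
Lemma transport_plans_compact (R : realType) (N : nat) :
  compact (@transport_plans R N).
Proof.
have -> : @transport_plans R N =
    [set G | forall i j, 0 <= G i j <= N%:R^-1] `&`
    \bigcap_(i in [set: 'I_N]) [set G | \sum_j G i j = N%:R^-1].
  apply/seteqP; split => G.
    move=> /transport_plansP[G0 GN]; split => [i j|i _] /=; last exact: GN.
    rewrite G0/= -(GN i) (bigD1 j)//= lerDl.
    by apply: sumr_ge0 => k _; exact: G0.
  move=> [hG GN]; apply/transport_plansP; split => [i j|i]; last exact: GN.
  by case/andP: (hG i j).
apply: (subclosed_compact _ (@mx_segment_compact R N N 0 N%:R^-1)); last first.
  exact: subIsetl.
apply: closedI; first by apply: compact_closed => //; exact: mx_segment_compact.
apply: closed_bigI => i _.
apply: (@preimage_closed _ _ (fun G : 'M[R]_N => \sum_j G i j)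
  [set y | y = N%:R^-1]); last exact: closed_eq.
move=> G _; apply: continuous_sum => j; exact: coord_continuous.
Qed.

Lemma transport_plans_convex (R : realType) (N : nat) (G H : 'M[R]_N) (s : R) :
  transport_plans G -> transport_plans H -> 0 <= s -> s <= 1 ->
  transport_plans (G + s *: (H - G)).
Proof.
move=> [G0 GN] [H0 HN] s0 s1; split => [i j|].
  rewrite !mxE; have -> : G i j + s * (H i j - G i j) =
    (1 - s) * G i j + s * H i j by ring.
  by rewrite addr_ge0// mulr_ge0// subr_ge0.
by rewrite mulmxDl -scalemxAl mulmxBl GN HN subrr scaler0 addr0.
Qed.

Lemma frob_continuous (R : realType) (N : nat) (A : 'M[R]_N) :
  continuous (frob A).
Proof.
have -> : frob A = fun G => \sum_i \sum_j A j i * G j i.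
  apply/funext => G; apply: eq_bigr => i _; rewrite mxE.
  by apply: eq_bigr => j _; rewrite mxE.
apply: continuous_sum => i; apply: continuous_sum => j G.
exact: (cvgMl_tmp (@coord_continuous _ _ _ j i G)).
Qed.

Lemma colsum_continuous (R : realType) (N : nat) (i : 'I_N) :
  continuous (fun G : 'M[R]_N => (G^T *m ones R N) i 0).
Proof.
have -> : (fun G : 'M[R]_N => (G^T *m ones R N) i 0) = fun G => \sum_j G j i.
  apply/funext => G; rewrite mxE.
  by apply: eq_bigr => j _; rewrite !mxE mulr1.
by apply: continuous_sum => j; exact: coord_continuous.
Qed.

(** Provides a real level for [lagrange_multiplier] when the two optimal values may be infinite. *)
Lemma fin_num_between (R : realType) (a b : \bar R) :
  (a < b)%E -> exists2 w : R, (a < w%:E)%E & (w%:E < b)%E.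
Proof.
case: a b => [l| |] [r| |] //; rewrite ?lte_fin => ab.
- by exists ((l + r) / 2); rewrite lte_fin; lra.
- by exists (l + 1); rewrite ?ltry// lte_fin; lra.
- by exists (r - 1); rewrite ?ltNyr// lte_fin; lra.
- by exists 0; rewrite ?ltNyr ?ltry.
Qed.

(** The hard half of strong duality: a real [w] strictly inside a duality gap would have a
    multiplier with dual value at least [w]. *)
Lemma wasserstein_le_lagrangian (R : realType) (V : normedModType R)
    (N B : nat) (x : 'I_N -> V) (p : 'cV[R]_N) :
  (wasserstein x B p <= lagrangian x B p)%E.
Proof.
rewrite leNgt; apply/negP => LW.
have [w Lw wW] : exists2 w : R, (lagrangian x B p < w%:E)%E &
    (w%:E < wasserstein x B p)%E.
  exact: fin_num_between.
(* [f] is [frob (dist_mx x)] and [g] the vector of column sums, written as compositions that carry a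
   linear structure. *)
pose f : {linear 'M[R]_N -> R^o} := mxtrace \o mulmx (dist_mx x)^T.
pose g : {linear 'M[R]_N -> 'cV[R]_N} := mulmxr (ones R N) \o trmx.
have [|||lam hlam] := @lagrange_multiplier R _ N
    (@transport_plans R N) f g (B%:R^-1 *: p) w
    (@transport_plans_compact R N)
    (fun u v s Ku Kv => transport_plans_convex R N u v s Ku Kv).
- exact: frob_continuous.
- exact: colsum_continuous.
- move=> G [G0 GN] gG; rewrite -lte_fin; apply: (lt_le_trans wW).
  by apply: ereal_inf_lbound; exists G.
have : (w%:E <= lagrangian x B p)%E; last by rewrite leNgt Lw.
apply: le_ereal_sup_tmp; exists (dual_value x B lam p); first by exists lam.
apply: le_ereal_inf_tmp => _ [G KG <-]; rewrite lee_fin; exact: hlam.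
Qed.

(** Pigeonhole: a 0/1 vector is determined by the Boolean function recording which entries equal
    1. *)
Lemma selections_repeat (R : realType) (N B : nat) (p : nat -> 'cV[R]_N) :
  (forall t, selections B (p t)) -> exists s t, (s < t)%N /\ p s = p t.
Proof.
move=> hp.
pose c t : {ffun 'I_N -> bool} := [ffun i => p t i 0 == 1].
have cE s t : c s = c t -> p s = p t.
  move=> e; apply/matrixP => i j; rewrite ord1.
  have := congr1 (fun h : {ffun _} => h i) e; rewrite !ffunE.
  have := oner_eq0 R; case: (hp s) (hp t) => [/(_ i) hs _] [/(_ i) ht _].
  by case: hs ht => -> [] ->; rewrite ?eqxx// eq_sym => ->.
pose n := #|{ffun 'I_N -> bool}|.
have /injectivePn[s [t st e]] : ~~ injectiveb (fun t : 'I_n.+1 => c t).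
  by apply/injectiveP => /leq_card; rewrite card_ord ltnn.
have : (s < t)%N || (t < s)%N by rewrite -neq_ltn.
move=> /orP[lt|lt]; [exists s, t|exists t, s]; split => //; exact: cE.
Qed.

Theorem corollary1 (R : realType) (V : normedModType R) (N B : nat)
    (x : 'I_N -> V) (hB1 : (1 <= B)%N) (hBN : (B <= N)%N)
    (p lam : nat -> 'cV[R]_N) (eta : nat -> R) (Lam : nat -> set 'cV[R]_N)
    (hLam0 : Lam 0%N = set0)
    (hp0 : selections B (p 0%N))
    (hlam : forall t : nat, optimal_dual x B (p t) (lam t))
    (hLamS : forall t : nat, Lam t.+1 = Lam t `|` [set lam t])
    (hrmp : forall t : nat,
       rmp_optimal x B (Lam t.+1) (eta t.+1) (p t.+1))
    (eps : R) (heps : 0 < eps) :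
  exists t : nat, (1 <= t)%N /\
    (wasserstein x B (p t) - (eta t)%:E < eps%:E)%E.
Proof.
have hp t : selections B (p t) by case: t => [//|t]; case: (hrmp t) => -[].
(* Cuts are never discarded. *)
have Lam_mem s t : (s < t)%N -> Lam t (lam s).
  elim: t => // t IH; rewrite ltnS leq_eqVlt hLamS.
  by move=> /predU1P[->|/IH]; [right|left].
have [s [t []]] := selections_repeat R N B p hp.
(* The later index of a repetition is positive, so [eta] is constrained there by [hrmp]. *)
case: t => // t st pst.
exists t.+1; split => //.
have [[_ hfeas] _] := hrmp t.
have Wle : (wasserstein x B (p t.+1) <= (eta t.+1)%:E)%E.
  apply: le_trans (hfeas _ (Lam_mem _ _ st)).
  by rewrite -pst hlam; exact: wasserstein_le_lagrangian.
(* The gap is already at most 0 at this index, whatever [eps] is. *)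
apply: (@le_lt_trans _ _ 0%E); last by rewrite lte_fin.
by rewrite leeBlDr// add0e.
Qed.
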